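(* Let $p$ be a prime, $q=p^h$, and $0<j<k<n$. Then every minimum weight code word of $\mathcal{C}_{j,k}(n,q)^\perp$ is a pull-back, i.e.\ there is a $(j-1)$-space $\iota$ contained in every $j$-space of its support.
   Context: $\textnormal{PG}(n,q)$ is the Desarguesian projective space over $\mathbb F_q$; $G_j$ its set of $j$-spaces; $V(j,n,q)=\mathbb F_p^{G_j}$ with scalar product $v\cdot w=\sum_{\lambda\in G_j}v(\lambda)w(\lambda)$. A $k$-space $\kappa$ is identified with $\kappa^{(j)}$ ($1$ on $j$-spaces inside $\kappa$, $0$ elsewhere); $\mathcal{C}_{j,k}(n,q)$ is the $\mathbb F_p$-span of these, and $\mathcal{C}_{j,k}(n,q)^\perp=\{v: v\cdot c=0\ \forall c\in\mathcal{C}_{j,k}(n,q)\}$. Support and weight are as usual; minimum weight code words are nonzero code words of smallest weight. A pull-back is a code word of the form $c^+_\iota$: for a $(j-1)$-space $\iota$, an $(n-j)$-space $\pi$ skew to $\iota$ and $c\in\mathcal{C}_{0,k-j}(\pi)^\perp$ (code of points and $(k-j)$-spaces of $\pi$), $c^+_\iota(\lambda)=c(\lambda\cap\pi)$ if $\iota\subset\lambda$ and $0$ otherwise; equivalently, a code word all of whose support elements contain a common $(j-1)$-space. *)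

(* Defs.v *)
From HB Require Import structures.
From mathcomp Require Import all_boot all_order all_algebra.

Set Implicit Arguments.
Unset Strict Implicit.
Unset Printing Implicit Defensive.

Import GRing.Theory.
Local Open Scope ring_scope.

(* A subspace is represented by its canonical row-space matrix, so over a finite
   field the type of subspaces is finite. *)
Section FiniteVspace.

Import VectorInternalTheory.
Variables (F : finFieldType) (V : vectType F).

HB.instance Definition _ := [Countable of {vspace V} by <:].
HB.instance Definition _ := [Finite of {vspace V} by <:].

End FiniteVspace.

Section Codes.

Variables (F : finFieldType) (V : vectType F) (p : nat).
Implicit Types W : {vspace V}.

(* Dimensions are projective: a d-space has vector space dimension d + 1.
   W plays the role of the ambient projective space, so that the codes are also
   available inside a subspace of PG(n, q). *)
Definition is_flat W (d : nat) : pred {vspace V} :=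
  fun U => (U <= W)%VS && (\dim U == d.+1).

Definition flat W (d : nat) := {U : {vspace V} | is_flat W d U}.

(* ('F_p)^o is 'F_p seen as a vector space over itself. *)
Definition word W (j : nat) := {ffun flat W j -> ('F_p)^o}.

Definition dotw W j (v w : word W j) : 'F_p := \sum_l (v l * w l).

Definition flat_word W j k (K : flat W k) : word W j :=
  [ffun l : flat W j => (val l <= val K)%VS%:R].

Definition code W j k : {vspace word W j} :=
  <<[seq flat_word j K | K : flat W k]>>%VS.

Definition dual_code W j k (v : word W j) : Prop :=
  forall c : word W j, c \in code W j k -> dotw v c = 0.

Definition weight W j (v : word W j) : nat := #|support v|.

Definition min_weight_word W j (D : word W j -> Prop) (v : word W j) : Prop :=
  [/\ D v, v != 0
    & forall w : word W j, D w -> w != 0 -> (weight v <= weight w)%N].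

(* The value of c at U, or 0 if U is not a j-space of W. *)
Definition eval_at W j (c : word W j) (U : {vspace V}) : ('F_p)^o :=
  if insub U is Some l then c l else 0.

(* When pi is a complement of iota in W, and iota is a (j-1)-space contained in
   the j-space l of W, the intersection of l and pi is a point of pi, so that
   the default value of eval_at is not used. *)
Definition pullback W j (iota pi : {vspace V}) (c : word pi 0) : word W j :=
  [ffun l : flat W j =>
     if (iota <= val l)%VS then eval_at c (val l :&: pi)%VS else 0].

End Codes.

Arguments code {F V} p W j k.
Arguments dual_code {F V} p W j k v.
Arguments pullback {F V p} W j iota pi c.

(* The points of PG(n, q) are the 1-dimensional subspaces of F_q^(n+1). *)
Definition PG (F : finFieldType) (n : nat) : {vspace 'rV[F]_n.+1} := fullv.

Definition is_pullback (F : finFieldType) (p n j k : nat)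
    (v : word p (PG F n) j) : Prop :=
  exists (iota : flat (PG F n) (j - 1)) (pi : flat (PG F n) (n - j))
         (c : word p (val pi) 0),
    [/\ (val iota :&: val pi = 0)%VS,
        dual_code p (val pi) 0 (k - j) c
      & v = pullback (PG F n) j (val iota) (val pi) c].

Arguments is_pullback {F p n j} k v.

(* Main.v *)
(* For a dual word v and a hyperplane H, the section of v by H takes at M the sum
   of v over the elements not inside H that meet H in M. It is a dual word of H
   for dimensions one less, and its weight is at most that of v. So if some
   hyperplane M of a support element L lies in no other support element, a
   hyperplane H with L n H = M gives a nonzero section, and induction bounds the
   weight of v from below by the minimum weight D(k - j, n - j) of the dual code
   of points and (k - j)-spaces in dimension n - j. If instead every hyperplane
   of L lies in a second support element, then so many hyperplanes contain
   support elements that averaging the induction hypothesis over them, together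
   with the cone bound D(r, m + 1) <= q D(r, m), makes the weight strictly larger
   than D(k - j, n - j). Since pull-backs have weight D(k - j, n - j), only the
   first case occurs for a minimum weight word, the section then has full weight,
   and intersecting with H is injective on the support. Hence the support
   elements pairwise meet in codimension 1, and all of them through the same
   subspace. *)
Require Import Defs.
From HB Require Import structures.
From mathcomp Require Import all_boot all_order all_algebra zify.

Set Implicit Arguments.
Unset Strict Implicit.
Unset Printing Implicit Defensive.

Import GRing.Theory.
Local Open Scope ring_scope.

(* Plain lia is very slow when the context mentions subspaces. *)
Ltac dim_lia :=
  repeat match goal with
  | H : is_true (leq _ _) |- _ => revert H
  | H : is_true (andb (leq _ _) (leq _ _)) |- _ => revert H
  | H : @eq ?T ?m ?n |- _ => unify T nat; change (@eq nat m n) in H; revert H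
  end;
  repeat match goal with
  | |- context [@dimv ?K ?V ?U] =>
      let d := fresh "d" in move: (@dimv K V U) => d
  end;
  clear; lia.

(** * Counting hyperplanes *)

Section Subspaces.

Variables (F : finFieldType) (V : vectType F).
Implicit Types A B H I K L M P Q S W X : {vspace V}.

Definition subs W a := [set L : {vspace V} | (L <= W)%VS && (\dim L == a)].

Lemma subsP W a L : reflect ((L <= W)%VS /\ \dim L = a) (L \in subs W a).
Proof. by rewrite inE; apply: (iffP andP) => -[LW /eqP]. Qed.

Lemma subsS W W' a : (W' <= W)%VS -> subs W' a \subset subs W a.
Proof.
move=> W'W; apply/subsetP => L /subsP[LW' dL].
by apply/subsP; split=> //; apply: subv_trans W'W.
Qed.

Lemma dim_add_line A x : x \notin A -> \dim (A + <[x]>) = (\dim A).+1.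
Proof.
move=> xA; have x0 : x != 0 by apply: contraNneq xA => ->; rewrite mem0v.
rewrite dimv_disjoint_sum ?dim_vline ?x0 ?addn1 //.
apply/eqP; rewrite -subv0; apply/subvP => y; rewrite memv_cap => /andP[yA].
case/vlineP=> c yE; rewrite memv0; have [c0|c0] := eqVneq c 0.
  by rewrite yE c0 scale0r.
case/negP: xA; have -> : x = c^-1 *: y by rewrite yE scalerA mulVf // scale1r.
by rewrite memvZ.
Qed.

Lemma ltv_exists A B : (A <= B)%VS -> (\dim A < \dim B)%N ->
  exists2 x, x \in B & x \notin A.
Proof.
move=> AB dAB; apply/subvPn; apply/negP => /dimvS; dim_lia.
Qed.

Lemma eq_subv_dim A B : (A <= B)%VS -> (\dim B <= \dim A)%N -> A = B.
Proof. by move=> AB dBA; apply/eqP; rewrite eqEdim AB. Qed.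

Lemma subv_between A B s : (A <= B)%VS -> (\dim A <= s <= \dim B)%N ->
  exists X, [/\ (A <= X)%VS, (X <= B)%VS & \dim X = s].
Proof.
move=> AB /andP[]; elim: s => [|s IHs].
  by rewrite leqn0 => /eqP dA _; exists A.
rewrite leq_eqVlt => /predU1P[<- _|]; first by exists A.
rewrite ltnS => As sB; have [X [AX XB dX]] := IHs As (ltnW sB).
have [|x xB xX] := ltv_exists XB; first by rewrite dX.
exists (X + <[x]>)%VS; split; last by rewrite dim_add_line // dX.
  exact: subv_trans (addvSl _ _).
by rewrite subv_add XB -memvE.
Qed.

Lemma dim_cap_hyperplane W H L : H \in subs W (\dim W).-1 -> (L <= W)%VS ->
  ~~ (L <= H)%VS -> \dim (L :&: H) = (\dim L).-1.
Proof.
move=> /subsP[HW dH] LW LH.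
have := dimv_sum_cap L H.
have LHW : (L + H <= W)%VS by rewrite subv_add LW.
have : (\dim (L :&: H) < \dim L)%N.
  rewrite ltnNge; apply: contra LH => LH.
  by rewrite -(eq_subv_dim (capvSl _ _) LH) capvSr.
move: (dimvS LHW); dim_lia.
Qed.

Definition hyperplanes W A := [set H in subs W (\dim W).-1 | (A <= H)%VS].

(* For y outside A + <[x]>, a hyperplane through A that avoids x contains
   y - t *: x for exactly one t. *)
Lemma card_hyperplanes_avoiding W A x :
    (A <= W)%VS -> x \in W -> x \notin A ->
  #|[set H in hyperplanes W A | x \notin H]|
    = (#|F| ^ (\dim W - \dim A).-1)%N.
Proof.
move: {2}(\dim W - \dim A)%N (erefl (\dim W - \dim A)%N) => m.
elim: m A => [|m IHm] A dm AW xW xA.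
  by case/negP: xA; rewrite (eq_subv_dim AW) //; dim_lia.
have AxW : (A + <[x]> <= W)%VS by rewrite subv_add AW -memvE.
have dAx := dim_add_line xA.
rewrite dm /=; case: m => [|m] in IHm dm *.
  rewrite expn0; apply/eqP/cards1P; exists A; apply/setP => H.
  rewrite !inE; apply/idP/eqP => [/andP[/andP[/andP[HW /eqP dH] AH] xH]|->].
    by apply/esym/eq_subv_dim => //; dim_lia.
  by rewrite AW subvv xA !andbT; apply/eqP; dim_lia.
have [|y yW yAx] := ltv_exists AxW; first by rewrite dAx; dim_lia.
pose z t := y - t *: x.
have zA t : z t \notin A.
  apply: contra yAx => ztA; have -> : y = z t + t *: x by rewrite subrK.
  by rewrite memv_add // memvZ // memv_line.
have zW t : z t \in W by rewrite memvB // memvZ.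
(* If [x = a + c *: z t] with [c] nonzero, solving for [y] would put [y] in [A + <[x]>]. *)
have xAz t : x \notin (A + <[z t]>)%VS.
  apply: contra yAx => /memv_addP[a aA [_ /vlineP[c ->] xE]].
  have [c0|c0] := eqVneq c 0.
    by case/negP: xA; rewrite xE c0 scale0r addr0.
  have -> : y = c^-1 *: (- a) + (c^-1 + t) *: x.
    have : c *: z t = x - a by rewrite xE addrC addKr.
    move/(congr1 (fun u => c^-1 *: u)); rewrite scalerA mulVf // scale1r.
    move/eqP; rewrite subr_eq => /eqP ->.
    by rewrite scalerBr scalerN scalerDl addrA [- _ + _]addrC.
  by rewrite memv_add ?memvZ ?memvN ?memv_line.
(* Since [H + <[x]> = W], writing [y = u + t *: x] with [u] in [H] puts [z t] in [H]. The union is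
   disjoint because distinct [z s] and [z t] differ by a nonzero multiple of [x]. *)
have part : [set H in hyperplanes W A | x \notin H] =
    \bigcup_t [set H in hyperplanes W (A + <[z t]>) | x \notin H].
  apply/setP => H; rewrite !inE; apply/idP/bigcupP => [|[t _]].
    move=> /andP[/andP[/andP[HW /eqP dH] AH] xH].
    have HxW : (H + <[x]> = W)%VS.
      apply: eq_subv_dim; first by rewrite subv_add HW -memvE.
      by rewrite dim_add_line //; dim_lia.
    have yHx : y \in (H + <[x]>)%VS by rewrite HxW.
    have /memv_addP[u uH [_ /vlineP[t ->] yE]] := yHx.
    exists t => //; rewrite !inE HW dH eqxx xH andbT /= subv_add AH -memvE.
    by rewrite /z yE addrK.
  by rewrite !inE subv_add => /andP[/andP[-> /andP[-> _]] ->].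
rewrite part -sum1_card partition_disjoint_bigcup /=; last first.
  move=> s t st; rewrite -setI_eq0; apply/eqP/setP => H; rewrite !inE.
  apply/negP => /andP[/andP[/andP[_ +] xH] /andP[/andP[_ +] _]].
  rewrite !subv_add -!memvE => /andP[_ zs] /andP[_ zt].
  case/negP: xH; have : z s - z t \in H by rewrite memvB.
  have -> : z s - z t = (t - s) *: x.
    by rewrite /z scalerBl opprB addrC addrA subrK.
  move=> /(memvZ (t - s)^-1); rewrite scalerA mulVf ?scale1r //.
  by rewrite subr_eq0 eq_sym.
rewrite (eq_bigr (fun=> (#|F| ^ m)%N)) => [|t _].
  by rewrite big_const iter_addn_0 mulnC expnS.
have dAz : \dim (A + <[z t]>) = (\dim A).+1 by rewrite dim_add_line.
have dWA : (\dim W - (\dim A).+1 = m.+1)%N by dim_lia.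
rewrite sum1_card IHm ?dAz ?dWA //.
by rewrite subv_add AW -memvE zW.
Qed.

Lemma hyperplanes_add_line W A x :
  [set H in hyperplanes W A | x \in H] = hyperplanes W (A + <[x]>).
Proof. by apply/setP => H; rewrite !inE subv_add -memvE andbA. Qed.

(** A vector [x] of [W] outside [A] splits the hyperplanes through [A]: those avoiding [x] give the
    top power of q, the others are the hyperplanes through [A + <[x]>]. The condition [0 < \dim W]
    excludes the zero space, which would count as its own hyperplane. *)
Lemma card_hyperplanes W A : (A <= W)%VS -> (0 < \dim W)%N ->
  #|hyperplanes W A| = (\sum_(i < \dim W - \dim A) #|F| ^ i)%N.
Proof.
move: {2}(\dim W - \dim A)%N (erefl (\dim W - \dim A)%N) => m.
elim: m A => [|m IHm] A dm AW W0.
  rewrite dm big_ord0; have WA : A = W by apply: (eq_subv_dim AW); dim_lia.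
  apply/eqP; rewrite cards_eq0; apply/eqP/setP => H; rewrite !inE WA.
  by apply/negP => /andP[/andP[_ /eqP dH] /dimvS]; dim_lia.
have [|x xW xA] := ltv_exists AW; first by dim_lia.
have dAx := dim_add_line xA.
rewrite -(cardsID [set H : {vspace V} | x \in H]) dm big_ord_recr /= addnC.
have -> : hyperplanes W A :\: [set H : {vspace V} | x \in H] =
          [set H in hyperplanes W A | x \notin H].
  by apply/setP => H; rewrite !inE andbC.
have -> : hyperplanes W A :&: [set H : {vspace V} | x \in H] =
          hyperplanes W (A + <[x]>).
  by rewrite -hyperplanes_add_line; apply/setP => H; rewrite !inE.
rewrite card_hyperplanes_avoiding // dm /= addnC IHm ?dAx //; try dim_lia.
  by have -> : (\dim W - (\dim A).+1 = m)%N by dim_lia.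
by rewrite subv_add AW -memvE.
Qed.

Lemma hyperplane_avoiding W A x : (A <= W)%VS -> x \in W -> x \notin A ->
  exists H, [/\ H \in subs W (\dim W).-1, (A <= H)%VS & x \notin H].
Proof.
move=> AW xW xA; have := card_hyperplanes_avoiding AW xW xA.
have [->|[H]] := set_0Vmem [set H in hyperplanes W A | x \notin H].
  have q0 : (0 < #|F|)%N by apply/card_gt0P; exists 0.
  by rewrite cards0 => /esym/eqP; rewrite eqn_leq leqNgt expn_gt0 q0.
by move=> HH _; exists H; move: HH; rewrite !inE => /andP[/andP[-> ->] ->].
Qed.

(** By the modular law [M + X] meets [L] only in [M], so a vector of [L] outside [M] can be avoided
    by a hyperplane through [M + X]. The freedom in [X] serves to force [H] through other support
    elements or their intersections. *)
Lemma hyperplane_cutting W L M X :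
    (L <= W)%VS -> (X <= W)%VS -> M \in subs L (\dim L).-1 -> (0 < \dim L)%N ->
    (X :&: L <= M)%VS ->
  exists H, [/\ H \in subs W (\dim W).-1, (X <= H)%VS & (L :&: H = M)%VS].
Proof.
move=> LW XW /subsP[ML dM] L0 XLM.
have [|x xL xM] := ltv_exists ML; first by dim_lia.
have xMX : x \notin (M + X)%VS.
  apply: contra xM => xMX.
  have : x \in (L :&: X + M)%VS by rewrite vspace_modr // memv_cap xL addvC.
  by rewrite capvC (addv_idPr XLM).
have MXW : (M + X <= W)%VS by rewrite subv_add XW (subv_trans ML).
have [H [HW MXH xH]] := hyperplane_avoiding MXW (subvP LW _ xL) xMX.
move: MXH; rewrite subv_add => /andP[MH XH]; exists H; split=> //.
apply/esym/eq_subv_dim; first by rewrite subv_cap ML.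
rewrite (dim_cap_hyperplane HW) ?dM //.
by apply: contra xH => /subvP; apply.
Qed.

(* K |-> K + <[y]> has fibers of size q. *)
Lemma dvdn_card_covers W H S y : H \in subs W (\dim W).-1 ->
    (S <= H)%VS -> y \in H -> y \notin S ->
  (#|F| %| #|[set K in subs W (\dim S).+1 | (S <= K)%VS & ~~ (K <= H)%VS]|)%N.
Proof.
move=> HW SH yH yS; have /subsP[HsW dH] := HW.
have SW := subv_trans SH HsW.
pose B := [set K in subs W (\dim S).+2 |
           (S + <[y]> <= K)%VS & ~~ (K <= H)%VS].
rewrite -sum1_card (partition_big (fun K => K + <[y]>)%VS (mem B)) /=.
  apply: dvdn_sum => K2; rewrite !inE => /and3P[/andP[K2W /eqP dK2] SK2 K2H].
  have yK2 : y \in K2 by rewrite memvE (subv_trans (addvSr S _)).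
  have SK2' := subv_trans (addvSl S <[y]>) SK2.
  rewrite sum1dep_card.
  (* The fiber over [K2] consists of the hyperplanes of [K2] through [S] that avoid [y]; as [S] has
     codimension 2 in [K2], there are q of them. *)
  suff -> : #|F| = #|[set K in hyperplanes K2 S | y \notin K]|.
    rewrite (eq_card (B := [set K in hyperplanes K2 S | y \notin K])) // => K.
    rewrite !inE; apply/idP/idP.
      move=> /andP[/and3P[/andP[KW /eqP dK] SK KH] /eqP KyE].
      have yK : y \notin K.
        apply/negP => yK; have : \dim (K + <[y]>) = (\dim S).+2 by rewrite KyE.
        by rewrite (addv_idPl yK) dK; dim_lia.
      by rewrite -KyE addvSl dim_add_line // SK yK eqxx.
    move=> /andP[/andP[/andP[KK2 /eqP dK] SK] yK].
    have KyE : (K + <[y]> = K2)%VS.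
      apply: eq_subv_dim; first by rewrite subv_add KK2 -memvE.
      by rewrite dim_add_line //; dim_lia.
    rewrite (subv_trans KK2 K2W) dK dK2 /= eqxx SK KyE eqxx andbT /=.
    by apply: contra K2H => KH; rewrite -KyE subv_add KH -memvE.
  by rewrite card_hyperplanes_avoiding // dK2 -addn2 addKn expn1.
move=> K; rewrite !inE => /and3P[/andP[KW /eqP dK] SK KH].
have KHS : (K :&: H = S)%VS.
  apply/esym/eq_subv_dim; first by rewrite subv_cap SK.
  by rewrite (dim_cap_hyperplane HW) // dK.
have yK : y \notin K by apply: contra yS => yK; rewrite -KHS memv_cap yK.
rewrite !subv_add KW -memvE (subvP HsW) // dim_add_line // dK eqxx /=.
rewrite (subv_trans SK) ?addvSl //= addvSr /=.
by apply: contra KH => /andP[].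
Qed.

(** * Dual words, sections and cones *)

Section Words.

Variable R : nzRingType.
Hypothesis card_F0 : #|F|%:R = 0 :> R.
Implicit Types f g : {vspace V} -> R.

(* Here a = j + 1 and b = k + 1 are vector space dimensions. *)
Definition dual_fun W a b f :=
  forall K, K \in subs W b -> \sum_(L in subs K a) f L = 0.

Definition supp_fun W a f := [set L in subs W a | f L != 0].

Lemma suppP W a f L :
  reflect [/\ (L <= W)%VS, \dim L = a & f L != 0] (L \in supp_fun W a f).
Proof. by rewrite !inE -andbA; apply: (iffP and3P) => -[? /eqP]. Qed.

Lemma dual_funS W W' a b f : (W' <= W)%VS -> dual_fun W a b f ->
  dual_fun W' a b f.
Proof. by move=> W'W fW K /(subsetP (subsS b W'W)); apply: fW. Qed.

(** For [M] of dimension [a - 1] the condition already excludes every [L] inside [H]. *)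
Definition section_fun W H a f M := \sum_(L in subs W a | (L :&: H)%VS == M) f L.

(* Sum f over all pairs L <= K where K contains S, has dimension b + 1 and is not
   inside H: modulo q, each L contributes as often as in the section sum over S. *)
Lemma dual_section W H a b f : H \in subs W (\dim W).-1 -> (b.+1 < \dim W)%N ->
  dual_fun W a.+1 b.+1 f -> dual_fun H a b (section_fun W H a.+1 f).
Proof.
move=> HW bW fW S /subsP[SH dS]; have /subsP[HsW dH] := HW.
have SW := subv_trans SH HsW.
pose C L := [set K in subs W b.+1 | [&& (S <= K)%VS, ~~ (K <= H)%VS & (L <= K)%VS]].
have capS K : (K <= W)%VS -> \dim K = b.+1 -> (S <= K)%VS -> ~~ (K <= H)%VS ->
    (K :&: H = S)%VS.
  move=> KW dK SK KH; apply/esym/eq_subv_dim; first by rewrite subv_cap SK.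
  by rewrite (dim_cap_hyperplane HW) // dK dS.
transitivity (\sum_(L in subs W a.+1 | (L :&: H)%VS \in subs S a) f L).
  rewrite [RHS](partition_big (fun L => (L :&: H)%VS) (mem (subs S a))) /=.
    apply: eq_bigr => M MS; apply: eq_bigl => L.
    by case: eqP => [->|]; rewrite ?andbF // MS !andbT.
  by move=> L /andP[].
transitivity (\sum_(L in subs W a.+1) f L *+ #|C L|); last first.
  transitivity (\sum_(K in subs W b.+1 | (S <= K)%VS && ~~ (K <= H)%VS)
                  \sum_(L in subs K a.+1) f L).
    rewrite (exchange_big_dep (mem (subs W a.+1))) /=.
      apply: eq_bigr => L LW; rewrite -sumr_const; apply: eq_bigl => K.
      by move: LW; rewrite !inE -!andbA => /andP[_ ->]; rewrite !andbT.
    by move=> K L /andP[/subsP[KW _] _]; apply/subsetP/subsS.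
  by rewrite big1 // => K /andP[KW _]; apply: fW.
(* It remains to show that [#|C L|] is 1 in [R] if [L :&: H] is an [a]-dimensional subspace of [S],
   where [S + L] is the only member, and 0 otherwise. *)
rewrite [LHS]big_mkcondr /=; apply: eq_bigr => L /subsP[LW dL].
have [LH|LH] := boolP (L <= H)%VS; last first.
  have dLH : \dim (L :&: H) = a by rewrite (dim_cap_hyperplane HW) // dL.
  case: ifPn => [/subsP[LHS _]|LHS].
    suff -> : C L = [set (S + L)%VS] by rewrite cards1.
    have dSL : \dim (S + L) = b.+1.
      have SLE : (S :&: L = L :&: H)%VS.
        apply/eqP; rewrite eqEsubv subv_cap capvSr (subv_trans (capvSl _ _)) //=.
        by rewrite subv_cap LHS capvSl.
      by have := dimv_sum_cap S L; rewrite SLE dLH dS dL; dim_lia.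
    apply/setP => K; rewrite !inE.
    apply/idP/eqP => [/andP[/andP[KW /eqP dK] /and3P[SK KH LK]]|->].
      by apply/esym/eq_subv_dim; rewrite ?subv_add ?SK // dSL dK.
    rewrite subv_add SW LW dSL eqxx addvSl addvSr /= andbT.
    by apply: contra LH => /(subv_trans (addvSr _ _)).
  suff -> : C L = set0 by rewrite cards0.
  apply/setP => K; rewrite !inE.
  apply/negP => /andP[/andP[KW /eqP dK] /and3P[SK KH LK]].
  case/negP: LHS; rewrite inE dLH eqxx andbT -(capS K) //.
  exact: capvS.
rewrite ifF; last by apply/negP => /subsP[_]; rewrite (capv_idPl LH) dL; dim_lia.
have [LS|LS] := boolP (L <= S)%VS.
  (* Here [L] lies in every [K] through [S], and the number of these is a multiple of q. *)
  have [|y yH yS] := ltv_exists SH; first by dim_lia.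
  have := dvdn_card_covers HW SH yH yS; rewrite dS.
  suff -> : [set K in subs W b.+1 | (S <= K)%VS & ~~ (K <= H)%VS] = C L.
    by case/dvdnP => c ->; rewrite mulrnA -mulr_natr card_F0 mulr0.
  apply/setP => K; rewrite !inE; case: (boolP (S <= K)%VS) => //= SK.
  by rewrite (subv_trans LS SK) andbT.
suff -> : C L = set0 by rewrite cards0.
apply/setP => K; rewrite !inE.
apply/negP => /andP[/andP[KW /eqP dK] /and3P[SK KH LK]].
by case/negP: LS; rewrite -(capS K) // subv_cap LK.
Qed.

(* d <= c * D(r, m), where D(r, m) is the minimum weight over all ambient spaces
   of dimension m at once, so that no isomorphism between them is needed. *)
Definition point_bound r m c d := forall W f, \dim W = m.+1 ->
  dual_fun W 1 r.+1 f -> supp_fun W 1 f != set0 ->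
  (d <= c * #|supp_fun W 1 f|)%N.

(* The cone over a word, without its vertex, multiplies the weight by q. *)
Lemma cone_bound r m c d : (m.+1 < \dim {:V})%N ->
  point_bound r m.+1 c d -> point_bound r m (c * #|F|) d.
Proof.
move=> mV bnd W f dW fW f0.
have [|x _ xW] := ltv_exists (subvf W); first by rewrite dW.
pose W2 := (W + <[x]>)%VS.
have dW2 : \dim W2 = m.+2 by rewrite dim_add_line // dW.
have WW2 : W \in subs W2 (\dim W2).-1.
  by apply/subsP; rewrite addvSl dW dW2.
have xW0 : (<[x]> :&: W = 0)%VS.
  apply/eqP; rewrite -subv0; apply/subvP => y; rewrite memv_cap memv0.
  case/andP=> /vlineP[c0 ->]; have [->|c00] := eqVneq c0 0.
    by rewrite scale0r.
  move=> /(memvZ c0^-1); rewrite scalerA mulVf // scale1r => xW'.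
  by rewrite xW' in xW.
(* [prj] projects from the vertex [<[x]>] onto [W]. So [g] repeats [f P] on the q points of the line
   [P + <[x]>] other than the vertex, and vanishes at the vertex. *)
pose prj Q := ((Q + <[x]>) :&: W)%VS.
pose g Q : R := if x \in Q then 0 else f (prj Q).
pose fiber P := [set Q in subs (P + <[x]>)%VS 1 | x \notin Q].
have notin P : (P <= W)%VS -> x \notin P.
  by move=> PW; apply: contra xW => /(subvP PW).
have card_fiber P : P \in subs W 1 -> #|fiber P| = #|F|.
  case/subsP=> PW dP.
  have dPx : \dim (P + <[x]>) = 2 by rewrite dim_add_line ?dP ?notin.
  have := @card_hyperplanes_avoiding (P + <[x]>)%VS 0%VS x (sub0v _).
  rewrite dPx dimv0 expn1 memv0 => <-; first last.
  - by apply: contra xW => /eqP ->; rewrite mem0v.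
  - by rewrite memvE addvSr.
  by apply: eq_card => Q; rewrite !inE dPx sub0v andbT.
have prjE P Q : P \in subs W 1 -> Q \in fiber P -> prj Q = P.
  move=> /subsP[PW dP]; rewrite !inE => /andP[/andP[QPx /eqP dQ] xQ].
  have QE : (Q + <[x]> = P + <[x]>)%VS.
    apply: eq_subv_dim; first by rewrite subv_add QPx addvSr.
    by rewrite (dim_add_line xQ) (dim_add_line (notin _ PW)) dP dQ.
  by rewrite /prj QE -vspace_modl // xW0 addv0.
have prjP Q : Q \in subs W2 1 -> x \notin Q ->
    prj Q \in subs W 1 /\ Q \in fiber (prj Q).
  move=> /subsP[QW2 dQ] xQ.
  have dQx : \dim (Q + <[x]>) = 2 by rewrite dim_add_line ?dQ.
  have dprj : \dim (prj Q) = 1.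
    rewrite (dim_cap_hyperplane WW2) ?dQx //; first by rewrite subv_add QW2 addvSr.
    by apply: contra xW; rewrite memvE; apply: subv_trans; apply: addvSr.
  split; first by rewrite inE capvSr dprj.
  rewrite !inE dQ eqxx xQ !andbT.
  have -> : (prj Q + <[x]> = Q + <[x]>)%VS.
    apply: eq_subv_dim; first by rewrite subv_add capvSl addvSr.
    by rewrite dQx dim_add_line ?dprj // notin // capvSr.
  exact: addvSl.
have gW : dual_fun W2 1 r.+1 g.
  move=> K /subsP[KW dK].
  have part : \sum_(Q in subs K 1) g Q =
      \sum_(P in subs W 1) f P *+ #|fiber P :&: subs K 1|.
    rewrite (bigID (fun Q : {vspace V} => x \in Q)) /= big1 ?add0r; last first.
      by move=> Q /andP[_ xQ]; rewrite /g xQ.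
    rewrite (partition_big prj (mem (subs W 1))) /=; last first.
      move=> Q /andP[/subsP[QK dQ] xQ]; case: (prjP Q) => //.
      by apply/subsP; split=> //; apply: subv_trans KW.
    apply: eq_bigr => P PW.
    rewrite -sumr_const; apply: eq_big => [Q|Q].
      rewrite in_setI; apply/idP/idP.
        move=> /andP[/andP[QK xQ] /eqP <-]; rewrite QK andbT.
        case: (prjP Q) => //; exact: (subsetP (subsS 1 KW)).
      move=> /andP[Qf QK]; rewrite QK (prjE P) // eqxx andbT /=.
      by move: Qf; rewrite !inE => /andP[].
    by move=> /andP[/andP[QK xQ] /eqP <-]; rewrite /g (negPf xQ).
  rewrite part; have [xK|xK] := boolP (x \in K).
    (* If [K] contains the vertex, a point [P] of [K] has its whole fiber in [K] and so counts q = 0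
       times; any other fiber misses [K]. *)
    apply: big1 => P PW; have [PK|PK] := boolP (P <= K)%VS.
      suff /setIidPl -> : fiber P \subset subs K 1.
        by rewrite card_fiber // -mulr_natr card_F0 mulr0.
      apply/subsetP => Q; rewrite !inE => /andP[/andP[QP ->] _]; rewrite andbT.
      by apply: subv_trans QP _; rewrite subv_add PK -memvE.
    suff -> : fiber P :&: subs K 1 = set0 by rewrite cards0.
    apply/setP => Q; rewrite in_setI in_set0; apply/negP => /andP[Qf /subsP[QK _]].
    case/negP: PK; rewrite -(prjE P Q) //; apply: subv_trans (capvSl _ _) _.
    by rewrite subv_add QK -memvE.
  (* If [K] avoids the vertex, [prj K] has the dimension of [K], and each of its points has exactly
     one fiber point in [K]. *)
  have KKx : K \in subs (K + <[x]>)%VS (\dim (K + <[x]>)).-1.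
    by apply/subsP; rewrite addvSl dim_add_line.
  have dKx := dim_add_line xK.
  have K'W : prj K \in subs W r.+1.
    apply/subsP; split; first exact: capvSr.
    rewrite (dim_cap_hyperplane WW2) ?dKx ?dK //.
      by rewrite subv_add KW addvSr.
    by apply: contra xW; rewrite memvE; apply: subv_trans; apply: addvSr.
  rewrite -[RHS](fW _ K'W) [LHS](bigID (fun P => P <= K + <[x]>)%VS) /=.
  rewrite [X in _ + X]big1 ?addr0 => [|P /andP[PW PK]]; last first.
    suff -> : fiber P :&: subs K 1 = set0 by rewrite cards0.
    apply/setP => Q; rewrite in_setI in_set0; apply/negP => /andP[Qf /subsP[QK _]].
    case/negP: PK; rewrite -(prjE P Q) //; apply: subv_trans (capvSl _ _) _.
    by rewrite addvS.
  apply: eq_big => [P|P /andP[/subsP[PW dP] PK]].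
    by rewrite !inE subv_cap andbC andbA.
  suff -> : fiber P :&: subs K 1 = [set ((P + <[x]>) :&: K)%VS] by rewrite cards1.
  have dPx : \dim (P + <[x]>) = 2 by rewrite dim_add_line ?dP ?notin.
  have dcap : \dim ((P + <[x]>) :&: K) = 1.
    rewrite (dim_cap_hyperplane KKx) ?dPx //.
      by rewrite subv_add PK addvSr.
    by apply: contra xK; rewrite memvE; apply: subv_trans; apply: addvSr.
  apply/setP => Q; rewrite !inE.
  apply/idP/eqP => [/andP[/andP[/andP[QP /eqP dQ] xQ] /andP[QK _]]|->].
    by apply: eq_subv_dim; rewrite ?subv_cap ?QP // dcap dQ.
  rewrite capvSl capvSr dcap eqxx !andbT /=.
  by apply: contra xK; rewrite memv_cap => /andP[].
have suppg Q : Q \in supp_fun W2 1 g ->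
    prj Q \in supp_fun W 1 f /\ Q \in fiber (prj Q).
  case/suppP=> QW dQ; rewrite /g; have [|xQ gQ] := boolP (x \in Q).
    by rewrite eqxx.
  case: (prjP Q) => //; first by apply/subsP.
  by move=> /subsP[pW dp] Qf; split=> //; apply/suppP.
have [P /suppP[PW dP fP]] := set0Pn _ f0.
have Pf : P \in fiber P by rewrite !inE addvSl dP eqxx notin.
have PW1 : P \in subs W 1 by apply/subsP.
have g0 : supp_fun W2 1 g != set0.
  apply/set0Pn; exists P; apply/suppP; split=> //.
    exact: subv_trans PW (addvSl _ _).
  by rewrite /g (negPf (notin _ PW)) (prjE P P).
apply: leq_trans (bnd W2 g dW2 gW g0) _; rewrite -mulnA leq_mul2l; apply/orP; right.
rewrite -[X in (X <= _)%N]sum1_card (partition_big prj (mem (supp_fun W 1 f))) /=.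
  rewrite mulnC -sum_nat_const; apply: leq_sum => S Sf.
  have SW : S \in subs W 1 by move: Sf; rewrite inE => /andP[].
  rewrite -(card_fiber S SW) sum1dep_card subset_leq_card //.
  by apply/subsetP => Q; rewrite inE => /andP[/suppg[_ Qf] /eqP <-].
by move=> Q /suppg[].
Qed.

(** The only test subspace is [W] itself, so all values sum to zero, and a single nonzero value
    cannot. *)
Lemma dual_full_weight W a f : dual_fun W a (\dim W) f ->
  supp_fun W a f != set0 -> (1 < #|supp_fun W a f|)%N.
Proof.
move=> fW f0; rewrite ltn_neqAle card_gt0 f0 andbT eq_sym.
apply/cards1P => -[L fL].
have /suppP[LW dL] : L \in supp_fun W a f by rewrite fL set11.
have := fW W; rewrite inE subvv eqxx => /(_ isT).
rewrite (bigD1 L) /=; last by rewrite inE LW dL eqxx.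
rewrite big1 => [|M /andP[MW ML]]; first by rewrite addr0 => ->; rewrite eqxx.
by apply: contraNeq ML => fM; rewrite -in_set1 -fL inE MW.
Qed.

(** The difference of two points is a dual word when the whole space is the only test subspace, so
    D(m, m) is at most 2. *)
Lemma point_bound_full m c d : (0 < m)%N -> (m < \dim {:V})%N ->
  point_bound m m c d -> (d <= c * 2)%N.
Proof.
move=> m0 mV bnd.
have [|W [_ _ dW]] := @subv_between _ _ m.+1 (sub0v {:V}); first by rewrite dimv0.
have [|P [_ PW dP]] := @subv_between _ _ 1 (sub0v W); first by rewrite dimv0 dW.
have [|x xW xP] := ltv_exists PW; first by rewrite dP dW.
have x0 : x != 0 by apply: contraNneq xP => ->; rewrite mem0v.
have PQ : P != <[x]>%VS by apply: contraNneq xP => ->; rewrite memv_line.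
pose g L : R := (L == P)%:R - (L == <[x]>%VS)%:R.
have gP : g P = 1 by rewrite /g eqxx (negPf PQ) subr0.
have gW : dual_fun W 1 m.+1 g.
  move=> K /subsP[KW dK]; have -> : K = W by apply: (eq_subv_dim KW); rewrite dW dK.
  have sum1 Q : Q \in subs W 1 -> \sum_(L in subs W 1) (L == Q)%:R = 1 :> R.
    move=> QW; rewrite (bigD1 Q) //= eqxx big1 ?addr0 // => L.
    by case/andP=> _ /negPf ->.
  rewrite sumrB !sum1 ?subrr //; apply/subsP; last by [].
  by rewrite -memvE dim_vline x0.
have g0 : supp_fun W 1 g != set0.
  by apply/set0Pn; exists P; apply/suppP; rewrite gP oner_neq0.
apply: leq_trans (bnd W g dW gW g0) _; rewrite leq_mul2l; apply/orP; right.
have : supp_fun W 1 g \subset [set P; <[x]>%VS].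
  apply/subsetP => L /suppP[_ _]; apply: contraR; rewrite !inE negb_or.
  by move=> /andP[/negPf LP /negPf LQ]; rewrite /g LP LQ subrr.
by move/subset_leq_card/leq_trans; apply; rewrite cards2 PQ.
Qed.

(** * The lower bound on the weight *)

(** A subtraction-free geometric sum formula: both sides are the sum with one more term. *)
Lemma geometric_sumS q m :
  (q * (\sum_(i < m) q ^ i) + 1 = \sum_(i < m) q ^ i + q ^ m)%N.
Proof.
elim: m => [|m IHm]; first by rewrite !big_ord0 muln0.
by rewrite !big_ord_recr /= mulnDr -expnS addnAC IHm.
Qed.

Definition isolates W a f L M := (M \in subs L a.-1) &&
  [forall (L' | L' \in supp_fun W a f), (M <= L')%VS ==> (L' == L)].

Lemma isolatesP W a f L M : isolates W a f L M ->
  M \in subs L a.-1 /\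
  forall L', L' \in supp_fun W a f -> (M <= L')%VS -> L' = L.
Proof.
case/andP=> ML /forall_inP sep; split=> // L' /sep /implyP ML' /ML'.
by move/eqP.
Qed.

(** Besides the hyperplanes through [L], each hyperplane [M] of [L] provides new ones: [M] lies in a
    second support element [L'], and every hyperplane through [L'] avoiding a fixed vector of [L]
    outside [L'] meets [L] exactly in [M]. *)
Lemma card_hit_hyperplanes W a f L : (1 < a < \dim W)%N ->
    L \in supp_fun W a f -> ~~ [exists M, isolates W a f L M] ->
  (#|F| * \sum_(i < \dim W - a) #|F| ^ i
    < #|[set H in subs W (\dim W).-1 | supp_fun H a f != set0]|)%N.
Proof.
move=> /andP[a1 aW] Lf noM; set hit := [set H in _ | _].
have /suppP[LW dL fL] := Lf.
have q0 : (0 < #|F|)%N by apply/card_gt0P; exists 0.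
have W0 : (0 < \dim W)%N by apply: leq_trans aW.
pose m := (\dim W - a)%N.
have card_cut M : M \in subs L a.-1 ->
    (#|F| ^ m.-1 <= #|[set H in hit | (L :&: H)%VS == M]|)%N.
  move=> ML; have /subsP[ML' dM] := ML.
  move: noM; rewrite negb_exists => /forallP/(_ M).
  rewrite /isolates ML negb_forall_in => /exists_inP[L' L'f].
  rewrite negb_imply => /andP[ML'' L'L].
  have /suppP[L'W dL' fL'] := L'f.
  have [x xL xL'] : exists2 x, x \in L & x \notin L'.
    apply/subvPn; apply: contra L'L => LL'.
    by rewrite eq_sym eqEdim LL' dL dL' /=.
  have := card_hyperplanes_avoiding L'W (subvP LW _ xL) xL'; rewrite dL' => <-.
  apply: subset_leq_card; apply/subsetP => H; rewrite !inE.
  move=> /andP[/andP[/andP[HW dH] L'H] xH]; rewrite HW dH /=.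
  apply/andP; split.
    by apply/set0Pn; exists L'; apply/suppP; rewrite dL'.
  rewrite eq_sym; apply/eqP/eq_subv_dim.
    by rewrite subv_cap ML' (subv_trans ML'').
  have HW' : H \in subs W (\dim W).-1 by rewrite inE HW.
  rewrite (dim_cap_hyperplane HW') ?dM ?dL ?leqnn //.
  by apply: contra xH => /subvP; apply.
have cardL : #|hyperplanes W L| = (\sum_(i < m) #|F| ^ i)%N.
  by rewrite card_hyperplanes // dL.
(* As [a] is at least 2, [L] has at least q + 1 hyperplanes. *)
have cardM : (#|F|.+1 <= #|subs L a.-1|)%N.
  have -> : subs L a.-1 = hyperplanes L 0.
    by apply/setP => M; rewrite !inE dL sub0v andbT.
  rewrite (card_hyperplanes (sub0v L)) dL ?(ltnW a1) // dimv0 subn0.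
  case: a a1 {aW m card_cut cardL hit noM Lf dL} => [|[|a]] // _.
  by rewrite 2!big_ord_recl expn0 expn1 addnA add1n leq_addr.
have : (#|hyperplanes W L| + #|subs L a.-1| * #|F| ^ m.-1 <= #|hit|)%N.
  rewrite -(cardsID [set H | L <= H]%VS hit); apply: leq_add.
    apply: subset_leq_card; apply/subsetP => H.
    rewrite !inE => /andP[/andP[HW dH] LH]; rewrite HW dH LH !andbT.
    by apply/set0Pn; exists L; apply/suppP.
  rewrite -sum_nat_const -[X in (_ <= X)%N]sum1_card.
  rewrite [X in (_ <= X)%N](partition_big (fun H => L :&: H)%VS
                              (mem (subs L a.-1))) /=.
    apply: leq_sum => M MS; apply: leq_trans (card_cut M MS) _.
    rewrite sum1dep_card; apply: subset_leq_card; apply/subsetP => H.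
    rewrite inE => /andP[Hhit /eqP HM].
    rewrite inE in_setD Hhit HM eqxx !andbT inE.
    apply: contraTN MS => /capv_idPl LH; rewrite -HM LH inE dL subvv /=.
    by rewrite neq_ltn orbC ltn_predL ltnW.
  move=> H; rewrite in_setD inE => /andP[LH]; rewrite inE => /andP[HW _].
  by rewrite /= inE capvSl (dim_cap_hyperplane HW) // dL eqxx.
move=> hitle; apply: leq_trans hitle; rewrite cardL -/m.
(* With s the geometric sum, the count is at least s + (q + 1) q^(m-1), while q s = s + q^m - 1. *)
have := geometric_sumS #|F| m.
have m0 : (0 < m)%N by rewrite subn_gt0.
have : (#|F|.+1 * #|F| ^ m.-1 <= #|subs L a.-1| * #|F| ^ m.-1)%N.
  by rewrite leq_mul2r cardM orbT.
have : (0 < #|F| ^ m.-1)%N by rewrite expn_gt0 q0.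
rewrite mulSn -expnS prednK //; move: (_ * _)%N (_ ^ m.-1)%N (_ ^ m)%N => u v w.
move: (\sum_(i < m) _)%N (_ * _)%N => s t; clear; lia.
Qed.

(** Double counting of pairs of a support element and a hyperplane containing it: more than [X]
    hyperplanes contain support elements, each contributes at least [d], and the total is at most
    [c * #|supp_fun W a f| * X]. *)
Lemma isolated_or_heavy W a f L c d : (1 < a < \dim W)%N -> (0 < d)%N ->
    L \in supp_fun W a f ->
    (forall H, H \in subs W (\dim W).-1 -> supp_fun H a f != set0 ->
       (d <= c * #|F| * #|supp_fun H a f|)%N) ->
  [exists M, isolates W a f L M] \/ (d < c * #|supp_fun W a f|)%N.
Proof.
move=> aW d0 Lf bnd.
have [|noM] := boolP [exists M, isolates W a f L M]; [by left | right].
set X := (#|F| * \sum_(i < \dim W - a) #|F| ^ i)%N.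
have := card_hit_hyperplanes aW Lf noM; set hit := [set H in _ | _] => ltX.
have count : (\sum_(H in subs W (\dim W).-1) #|supp_fun H a f| =
    #|supp_fun W a f| * \sum_(i < \dim W - a) #|F| ^ i)%N.
  transitivity (\sum_(L' in supp_fun W a f) #|hyperplanes W L'|)%N.
    under [LHS]eq_bigr do rewrite -sum1_card.
    rewrite (exchange_big_dep (mem (supp_fun W a f))) /=.
      apply: eq_bigr => L' /suppP[L'W dL' fL']; rewrite -sum1_card.
      by apply: eq_bigl => H; rewrite !inE dL' eqxx fL' !andbT.
    move=> H L' /subsP[HW _] /suppP[L'H dL' fL']; apply/suppP; split=> //.
    exact: subv_trans HW.
  rewrite -sum_nat_const; apply: eq_bigr => L' /suppP[L'W dL' _].
  by rewrite card_hyperplanes // ?dL' //; case/andP: aW => _; apply: leq_trans.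
have : (#|hit| * d <= c * #|supp_fun W a f| * X)%N.
  have -> : (c * #|supp_fun W a f| * X = c * #|F| *
      \sum_(H in subs W (\dim W).-1) #|supp_fun H a f|)%N.
    by rewrite count mulnACA.
  rewrite -sum_nat_const big_distrr /= [X in (_ <= X)%N](bigID (mem hit)) /=.
  apply: leq_trans (leq_addr _ _).
  rewrite [X in (_ <= X)%N](eq_bigl (mem hit)) => [|H].
    by apply: leq_sum => H; rewrite inE => /andP[]; apply: bnd.
  by apply: andb_idl => /=; rewrite inE => /andP[].
have X0 : (0 < X)%N.
  rewrite muln_gt0; apply/andP; split; first by apply/card_gt0P; exists 0.
  have : (0 < \dim W - a)%N by case/andP: aW => _; rewrite subn_gt0.
  by case: (\dim W - a)%N => // m _; rewrite big_ord_recl expn0.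
rewrite -(ltn_pmul2r X0); apply: leq_trans.
by rewrite [(d * _)%N]mulnC ltn_mul2r d0.
Qed.

Lemma supp_section W H a f : supp_fun H a (section_fun W H a.+1 f) \subset
  [set (L :&: H)%VS | L in [set L in supp_fun W a.+1 f | ~~ (L <= H)%VS]].
Proof.
apply/subsetP => M /suppP[MH dM fM].
have [L LW fL] : exists2 L, (L \in subs W a.+1) && ((L :&: H)%VS == M) & f L != 0.
  apply/exists_inP; apply: contraNT fM; rewrite negb_exists_in => /forall_inP f0.
  by apply/eqP/big1 => L /f0; rewrite negbK => /eqP.
case/andP: LW => LW /eqP LHM; apply/imsetP; exists L => //.
rewrite !inE fL andbT; move: LW; rewrite inE => /andP[-> /eqP dL].
rewrite dL eqxx /=; apply/negP => LH.
by move: dM; rewrite -LHM (capv_idPl LH) dL => /esym/n_Sn.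
Qed.

(** The sum defining the section at [M] reduces to its single nonzero term [f L]. *)
Lemma section_isolated W H a f L M : L \in supp_fun W a.+1 f ->
    isolates W a.+1 f L M -> (L :&: H = M)%VS ->
  M \in supp_fun H a (section_fun W H a.+1 f).
Proof.
move=> Lf /isolatesP[/subsP[ML dM] sep] LHM; have /suppP[LW dL fL] := Lf.
apply/suppP; split=> //; first by rewrite -LHM capvSr.
rewrite /section_fun (bigD1 L) /=; last by rewrite inE LW dL LHM !eqxx.
rewrite big1 ?addr0 // => L' /andP[/andP[/subsP[L'W dL'] /eqP L'HM] L'L].
apply: contraNeq L'L => fL'; apply/eqP/sep; first exact/suppP.
by rewrite -L'HM capvSl.
Qed.

(** Sectioning lowers [a], [b] and [\dim W] together and keeps both parameters of [point_bound].
    Restricting to a hyperplane lowers only [\dim W], which costs a factor q by [cone_bound]; the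
    factor [c] collects these powers. *)
Lemma weight_bound W a b f c d : (0 < a < b)%N -> (b <= \dim W)%N ->
    dual_fun W a b f -> supp_fun W a f != set0 ->
    point_bound (b - a) (\dim W - a) c d ->
  (d <= c * #|supp_fun W a f|)%N.
Proof.
move: {2}(\dim W) (erefl (\dim W)) => N.
elim: N W a b f c d => [|N IHN] W a b f c d dW ab bW fW f0 bnd.
  by exfalso; move: ab bW; rewrite dW; case: a b {fW f0 bnd} => // a [].
have [/andP[a0 ltab] dimV] := (ab, dimvS (subvf W)).
case: (posnP d) => [->//|d0].
have [bW'|bN] := ltnP b (\dim W); last first.
  have bE : b = \dim W by apply/eqP; rewrite eqn_leq bW.
  rewrite bE in fW ltab bnd; apply: leq_trans (point_bound_full _ _ bnd) _.
  - by rewrite subn_gt0.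
  - by apply: leq_trans dimV; rewrite ltn_subrL a0 dW.
  by rewrite leq_mul2l (dual_full_weight fW) ?orbT.
case: a => [//|a] in ab fW f0 bnd ltab a0 *.
case: b => [//|b] in ab fW bnd ltab bW bW' *.
case: a => [|a] in ab fW f0 bnd ltab a0 *.
  by apply: bnd => //; rewrite ?subn1 ?dW.
have dH H : H \in subs W (\dim W).-1 -> \dim H = N.
  by case/subsP => _ ->; rewrite dW.
have aW : (1 < a.+2 < \dim W)%N by rewrite /= (ltn_trans ltab).
have [L Lf] := set0Pn _ f0; have /suppP[LW dL fL] := Lf.
have [H HW H0|/existsP[M /isolatesP[ML sep]]|/ltnW//] :=
    isolated_or_heavy (c := c) aW d0 Lf.
  (* The dichotomy needs a bound in each hyperplane: this is the induction hypothesis for the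
     restriction of [f], with [c * #|F|] for [c]. *)
  have /subsP[HsW _] := HW.
  apply: (IHN H a.+2 b.+1 f _ d (dH _ HW) ab) => //.
  - by rewrite dH // -ltnS -dW.
  - exact: dual_funS fW.
  rewrite dH //; apply: cone_bound.
    by apply: leq_trans dimV; rewrite dW !ltnS; lia.
  by rewrite -subSn -?dW //; move: bW' ltab; rewrite dW; lia.
have ML' : M \in subs L (\dim L).-1 by rewrite dL.
have L0 : (0 < \dim L)%N by rewrite dL.
have XLM : (0 :&: L <= M)%VS by rewrite cap0v sub0v.
have [H [HW _ LHM]] := hyperplane_cutting LW (sub0v W) ML' L0 XLM.
have sec := dual_section HW bW' fW; have LM : isolates W a.+2 f L M.
  rewrite /isolates ML; apply/forall_inP => L' L'f; apply/implyP.
  by move=> /(sep _ L'f) ->.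
have Msec := section_isolated Lf LM LHM.
have sec0 : supp_fun H a.+1 (section_fun W H a.+2 f) != set0.
  by apply/set0Pn; exists M.
have bnd' : point_bound (b - a.+1) (\dim H - a.+1) c d.
  by rewrite dH //; move: bnd; rewrite dW !subSS.
apply: leq_trans (IHN H a.+1 b _ c d (dH _ HW) _ _ sec sec0 bnd') _ => //.
  by rewrite dH // -ltnS -dW.
rewrite leq_mul2l; apply/orP; right.
apply: leq_trans (subset_leq_card (supp_section _ _ _ _)) _.
apply: leq_trans (leq_imset_card _ _) _.
by apply: subset_leq_card; apply/subsetP => L'; rewrite inE => /andP[].
Qed.

(** * The support of a word of minimum weight *)

Lemma heavy_hyperplane W H a b f c d : (0 < a < b)%N -> (b < \dim W)%N ->
    dual_fun W a b f -> point_bound (b - a) (\dim W - a) c d ->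
    H \in subs W (\dim W).-1 -> supp_fun H a f != set0 ->
  (d <= c * #|F| * #|supp_fun H a f|)%N.
Proof.
move=> ab bW fW bnd /subsP[HW dH] H0; have /andP[a0 ltab] := ab.
apply: (weight_bound ab _ (dual_funS HW fW) H0).
  by rewrite dH -ltnS prednK // (leq_trans _ bW).
have dV := dimvS (subvf W).
rewrite dH; apply: cone_bound.
  by move: a0 ltab bW dV; move: (\dim W) (\dim {:V}) => n n'; clear; lia.
suff -> : ((\dim W).-1 - a).+1 = (\dim W - a)%N by [].
by move: ltab bW; move: (\dim W) => n; clear; lia.
Qed.

(** The section has weight at least that of [f] by the lower bound, and at most the number of
    support elements not inside [H]. All inequalities in this chain are therefore equalities. *)
Lemma isolating_section W a b f L M H : (0 < a < b)%N -> (b.+1 < \dim W)%N ->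
    dual_fun W a.+1 b.+1 f ->
    point_bound (b - a) (\dim W - a.+1) 1 #|supp_fun W a.+1 f| ->
    L \in supp_fun W a.+1 f -> isolates W a.+1 f L M ->
    H \in subs W (\dim W).-1 -> (L :&: H = M)%VS ->
  [/\ forall L', L' \in supp_fun W a.+1 f -> ~~ (L' <= H)%VS,
      {in supp_fun W a.+1 f &, injective (fun L' => L' :&: H)%VS}
    & supp_fun H a (section_fun W H a.+1 f)
        = [set (L' :&: H)%VS | L' in supp_fun W a.+1 f]].
Proof.
move=> ab bW fW bnd Lf LM HW LHM.
have sec := dual_section HW bW fW.
have Msec := section_isolated Lf LM LHM.
have sec0 : supp_fun H a (section_fun W H a.+1 f) != set0.
  by apply/set0Pn; exists M.
have /subsP[_ dH] := HW.
have dHa : (\dim H - a = \dim W - a.+1)%N by rewrite dH subnS -!subn1 subnAC.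
have le1 : (#|supp_fun W a.+1 f| <= #|supp_fun H a (section_fun W H a.+1 f)|)%N.
  rewrite -[X in (_ <= X)%N]mul1n; apply: (weight_bound ab _ sec sec0).
    by rewrite dH -ltnS prednK ?(ltnW bW) // (leq_trans _ bW).
  by rewrite dHa.
set D := [set L' in supp_fun W a.+1 f | ~~ (L' <= H)%VS].
have subD : D \subset supp_fun W a.+1 f.
  by apply/subsetP => L'; rewrite inE => /andP[].
have le2 := subset_leq_card (supp_section W H a f); rewrite -/D in le2.
have le3 := leq_imset_card (fun L' => L' :&: H)%VS (mem D).
have DE : D = supp_fun W a.+1 f.
  by apply/eqP; rewrite eqEcard subD (leq_trans le1) // (leq_trans le2).
rewrite DE in le2 le3; split.
- by move=> L'; rewrite -DE inE => /andP[].
- by apply/imset_injP; rewrite eqn_leq le3 (leq_trans le1).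
apply/eqP; rewrite eqEcard; have := supp_section W H a f; rewrite -/D DE => ->.
exact: leq_trans le3 le1.
Qed.

Lemma dim_lt_not_sub A M X : (A <= X)%VS -> (A <= M)%VS -> ~~ (X <= M)%VS ->
  (\dim A < \dim X)%N.
Proof.
move=> AX AM; apply: contraR; rewrite -leqNgt => dXA.
by rewrite -(eq_subv_dim AX dXA).
Qed.

(** Induction through a section yields a common subspace [A] of one dimension too few. It lies in
    the isolated [M], so an intersection of support elements that is not inside [M] is strictly
    larger than [A]. *)
Lemma common_subspace W a b f : (0 < a < b)%N -> (b < \dim W)%N ->
    dual_fun W a b f -> supp_fun W a f != set0 ->
    point_bound (b - a) (\dim W - a) 1 #|supp_fun W a f| ->
  exists2 A, \dim A = a.-1 & forall L, L \in supp_fun W a f -> (A <= L)%VS.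
Proof.
elim: a W b f => [//|a IHa] W b f ab bW fW f0 bnd.
have [a0|a0] := posnP a.
  by exists 0%VS => [|L _]; rewrite ?dimv0 ?a0 ?sub0v.
case: b => [|b] in ab bW fW bnd *; first by case/andP: ab.
have ab' : (0 < a < b)%N by rewrite a0 -ltnS; case/andP: ab.
set S := supp_fun W a.+1 f in f0 bnd *.
have cut L : L \in S -> exists M, isolates W a.+1 f L M.
  move=> Lf.
  have [||H HW H0|/existsP//|] :=
      isolated_or_heavy (c := 1) (d := #|S|) _ _ Lf.
  - rewrite ltnS a0 /=; case/andP: ab => _ ltab; exact: ltn_trans bW.
  - by rewrite card_gt0.
  - exact: heavy_hyperplane bnd HW H0.
  - by rewrite mul1n ltnn.
have propS L M : L \in S -> isolates W a.+1 f L M ->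
  exists A, [/\ \dim A = a.-1, (A <= M)%VS & forall L', L' \in S -> (A <= L')%VS].
  move=> Lf LM; have /suppP[LW dL _] := Lf; have [ML _] := isolatesP LM.
  have [|||H [HW _ LHM]] := @hyperplane_cutting W L M 0 LW (sub0v _).
  - by rewrite dL.
  - by rewrite dL.
  - by rewrite cap0v sub0v.
  have /subsP[_ dH] := HW.
  have [_ inj suppE] := isolating_section ab' bW fW bnd Lf LM HW LHM.
  have cardE : #|supp_fun H a (section_fun W H a.+1 f)| = #|S|.
    by rewrite suppE card_in_imset.
  have [|||A dA AL] := IHa H b _ ab' _ (dual_section HW bW fW).
  - by rewrite dH -ltnS prednK // (leq_trans _ bW).
  - by rewrite -card_gt0 cardE card_gt0.
  - by rewrite cardE dH -subn1 -subnDA add1n.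
  have AL' L' : L' \in S -> (A <= L' :&: H)%VS.
    by move=> L'f; apply: AL; rewrite suppE; apply: imset_f.
  exists A; split=> // [|L' /AL']; first by rewrite -LHM AL'.
  by rewrite subv_cap => /andP[].
have cap2 L L' : L \in S -> L' \in S -> L != L' -> \dim (L :&: L') = a.
  move=> Lf L'f LL'; have [M LM] := cut L Lf.
  have [A [dA AM AL]] := propS L M Lf LM; have [ML _] := isolatesP LM.
  have /suppP[LW dL _] := Lf; have /suppP[L'W dL' _] := L'f.
  apply/eqP; rewrite eqn_leq; apply/andP; split.
    rewrite -ltnS -[X in (_ < X)%N]dL ltnNge; apply: contra LL' => cap.
    have LcapE := eq_subv_dim (capvSl L L') cap.
    by rewrite eqEdim dL dL' leqnn andbT -LcapE capvSr.
  rewrite -(prednK a0) -dA; apply: (@dim_lt_not_sub _ M) => //.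
    by rewrite subv_cap !AL.
  (* Otherwise some hyperplane through [L'] cuts [L] in [M], although no support element may lie
     inside it. *)
  apply/negP => capM.
  have [|||H [HW L'H LHM]] := @hyperplane_cutting W L M L' LW L'W.
  - by rewrite dL.
  - by rewrite dL.
  - by rewrite capvC.
  have [/(_ _ L'f)] := isolating_section ab' bW fW bnd Lf LM HW LHM.
  by rewrite L'H.
have cap3 L L1 L2 : L \in S -> L1 \in S -> L2 \in S -> L1 != L2 ->
    (L1 :&: L2 <= L)%VS.
  move=> Lf L1f L2f L12; have [M LM] := cut L Lf.
  have [A [dA AM AL]] := propS L M Lf LM; have [ML _] := isolatesP LM.
  have /suppP[LW dL _] := Lf; have /suppP[L1W dL1 _] := L1f.
  have /suppP[L2W dL2 _] := L2f; have d12 := cap2 L1 L2 L1f L2f L12.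
  have [cap|cap] := boolP (L1 :&: L2 :&: L <= M)%VS.
    (* A hyperplane through [L1 :&: L2] cutting [L] in [M] would meet [L1] and [L2] in the same
       subspace, against injectivity. *)
    have X12 : (L1 :&: L2 <= W)%VS by apply: subv_trans (capvSl _ _) L1W.
    have [|||H [HW XH LHM]] := @hyperplane_cutting W L M (L1 :&: L2) LW X12 => //.
    - by rewrite dL.
    - by rewrite dL.
    have [noL inj _] := isolating_section ab' bW fW bnd Lf LM HW LHM.
    have capE L' : L' \in S -> (L1 :&: L2 <= L')%VS -> (L' :&: H = L1 :&: L2)%VS.
      move=> L'f XL'; have /suppP[L'W dL' _] := L'f.
      apply/esym/eq_subv_dim; first by rewrite subv_cap XL'.
      by rewrite (dim_cap_hyperplane HW) ?noL // dL' d12.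
    case/eqP: L12; apply: inj => //=.
    by rewrite !capE ?capvSl ?capvSr.
  have : (a <= \dim (L1 :&: L2 :&: L))%N.
    rewrite -(prednK a0) -dA; apply: (@dim_lt_not_sub _ M) => //.
    by rewrite !subv_cap !AL.
  rewrite -[X in (X <= _)%N]d12 => le.
  by rewrite -(eq_subv_dim (capvSl _ _) le) capvSr.
have [L Lf] := set0Pn _ f0.
have [/exists_inP[L' L'f LL']|] := boolP [exists L' in S, L != L'].
  by exists (L :&: L')%VS => [|L2 L2f]; [exact: cap2 | exact: cap3].
rewrite negb_exists_in => /forall_inP onlyL.
have [M /isolatesP[/subsP[ML dM] _]] := cut L Lf; have /suppP[_ dL _] := Lf.
exists M => [|L' /onlyL]; first by rewrite dM.
by rewrite negbK => /eqP <-.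
Qed.

(** * Pull-backs *)

(** Adding [A] and intersecting with [X] are inverse bijections between the points of [K :&: X] and
    the subspaces of [K] one dimension above [A] that contain it. *)
Lemma sum_pullback A X K (G : {vspace V} -> R) : (A :&: X = 0)%VS ->
    (A <= K)%VS -> (K <= A + X)%VS ->
  \sum_(L in subs K (\dim A).+1 | (A <= L)%VS) G L =
    \sum_(Q in subs (K :&: X) 1) G (A + Q)%VS.
Proof.
move=> AX AK KAX.
rewrite (reindex_onto (fun Q => A + Q)%VS (fun L => L :&: X)%VS) /=; last first.
  move=> L /andP[/subsP[LK dL] AL].
  by rewrite addvC vspace_modr // addvC (capv_idPl (subv_trans LK KAX)).
apply: eq_bigl => Q; rewrite addvSl andbT.
apply/idP/idP => [/andP[/subsP[AQK dAQ] /eqP QE]|/subsP[]].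
  rewrite -QE inE capvS //= QE.
  have := dimv_disjoint_sum (U := A) (V := Q); rewrite dAQ => dE.
  have QX : (Q <= X)%VS by rewrite -QE capvSr.
  have /dE/eqP : (A :&: Q = 0)%VS.
    by apply/eqP; rewrite -subv0 -AX capvS.
  by rewrite -addn1 eqn_add2l eq_sym.
rewrite subv_cap => /andP[QK QX] dQ.
have AQ : (A :&: Q = 0)%VS by apply/eqP; rewrite -subv0 -AX capvS.
rewrite inE subv_add AK QK dimv_disjoint_sum // dQ addn1 eqxx /=.
by rewrite addvC -vspace_modl // AX addv0.
Qed.

(** A test subspace not through [A] sees only zeros; for one through [A] the sum is that of [f] over
    the points of [K :&: X], which has dimension [r.+1]. *)
Lemma pullback_dual A X r f : (A :&: X = 0)%VS -> dual_fun X 1 r.+1 f ->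
  dual_fun (A + X) (\dim A).+1 (\dim A + r.+1)%N
    (fun L => if (A <= L)%VS then f (L :&: X)%VS else 0).
Proof.
move=> AX fX K /subsP[KAX dK]; rewrite -big_mkcondr /=.
have [AK|AK] := boolP (A <= K)%VS; last first.
  apply: big1 => L /andP[/subsP[LK _] AL].
  by case/negP: AK; apply: subv_trans LK.
rewrite (sum_pullback _ AX AK KAX).
have KX : (K :&: X)%VS \in subs X r.+1.
  apply/subsP; split; first exact: capvSr.
  apply/eqP; rewrite -(eqn_add2l (\dim A)) -dK -dimv_disjoint_sum.
    by rewrite addvC vspace_modr // addvC (capv_idPl KAX).
  by apply/eqP; rewrite -subv0 -AX capvS // capvSr.
rewrite -[RHS](fX _ KX); apply: eq_bigr => Q /subsP[QKX dQ].
by rewrite addvC -vspace_modl ?AX ?addv0 // (subv_trans QKX) // capvSr.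
Qed.

Lemma supp_pullback A X f : (A :&: X = 0)%VS ->
  supp_fun (A + X) (\dim A).+1 (fun L => if (A <= L)%VS then f (L :&: X)%VS else 0)
    = [set (A + Q)%VS | Q in supp_fun X 1 f].
Proof.
move=> AX; have AXQ Q : (Q <= X)%VS -> (A :&: Q = 0)%VS.
  by move=> QX; apply/eqP; rewrite -subv0 -AX capvS.
apply/setP => L; apply/suppP/imsetP => [[LAX dL]|[Q /suppP[QX dQ fQ] ->]].
  case: ifP => [AL fL|_]; last by rewrite eqxx.
  have LE : (A + (L :&: X) = L)%VS.
    by rewrite addvC vspace_modr // addvC (capv_idPl LAX).
  exists (L :&: X)%VS => //; apply/suppP; split=> //; first exact: capvSr.
  apply/eqP; rewrite -(eqn_add2l (\dim A)) addn1 -dL.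
  by rewrite -dimv_disjoint_sum ?AXQ ?capvSr // LE.
rewrite addvS // addvSl dimv_disjoint_sum ?AXQ // dQ addn1; split=> //.
by rewrite addvC -vspace_modl // AX addv0.
Qed.

End Words.

End Subspaces.

(** * Code words as functions on subspaces *)

Section FunctionsOfWords.

Variables (F : finFieldType) (V : vectType F) (p : nat).
Implicit Types (W U K : {vspace V}).

Lemma flat_subs W d (l : flat W d) : val l \in subs W d.+1.
Proof. by rewrite inE; apply: (valP l). Qed.

Lemma sum_flat W d K (G : {vspace V} -> 'F_p) : (K <= W)%VS ->
  \sum_(L in subs K d.+1) G L = \sum_(l : flat W d | (val l <= K)%VS) G (val l).
Proof.
move=> KW; rewrite (reindex_omap (val : flat W d -> {vspace V}) insub) /=.
  apply: eq_bigl => l; rewrite valK eqxx andbT inE.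
  by have /andP[_ ->] := valP l; rewrite andbT.
move=> L /subsP[LK dL]; rewrite insubT //=.
by rewrite /is_flat dL (subv_trans LK) ?eqxx.
Qed.

Lemma eval_at_val W j (v : word p W j) l : eval_at v (val l) = v l.
Proof. by rewrite /eval_at valK. Qed.

Lemma dot_flat_word W j k (v : word p W j) (K : flat W k) :
  dotw v (flat_word p j K) = \sum_(L in subs (val K) j.+1) eval_at v L.
Proof.
have /subsP[KW _] := flat_subs K.
rewrite (sum_flat _ _ KW) [RHS]big_mkcond /=; apply: eq_bigr => l _.
by rewrite ffunE eval_at_val; case: ifP => _; rewrite ?mulr1 ?mulr0.
Qed.

(** By linearity of [dotw], orthogonality to the span can be tested on its generators. *)
Lemma dual_codeP W j k (v : word p W j) :
  dual_code p W j k v <-> dual_fun W j.+1 k.+1 (eval_at v : _ -> 'F_p).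
Proof.
split=> [dv K KW|dv c cC].
  have Kf : is_flat W k K by move: KW; rewrite inE.
  rewrite -[K]/(val (Sub K Kf : flat W k)) -dot_flat_word; apply: dv.
  by apply/memv_span/map_f; rewrite mem_enum.
set s := [seq flat_word p j K | K : flat W k] in cC.
rewrite (coord_span (X := in_tuple s) cC).
have dotD : {morph @dotw F V p W j v : x y / x + y >-> x + y}.
  move=> x y; rewrite /dotw -big_split; apply: eq_bigr => l _.
  by rewrite ffunE mulrDr.
have dot0 : dotw v 0 = 0 by rewrite /dotw big1 // => l _; rewrite ffunE mulr0.
rewrite (big_morph _ dotD dot0) big1 // => i _.
have /mapP[K _ ->] : s`_i \in s by rewrite mem_nth.
set a := coord _ _ _; transitivity (a * dotw v (flat_word p j K)).
  rewrite /dotw mulr_sumr; apply: eq_bigr => l _; rewrite ffunE.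
  exact: mulrCA.
by rewrite dot_flat_word dv ?mulr0 // flat_subs.
Qed.

Lemma supp_eval W j (v : word p W j) :
  supp_fun W j.+1 (eval_at v : _ -> 'F_p) = [set val l | l in support v].
Proof.
apply/setP => L; apply/suppP/imsetP => [[LW dL fL]|[l vl ->]].
  have Lf : is_flat W j L by rewrite /is_flat LW dL eqxx.
  exists (Sub L Lf : flat W j) => //.
  by rewrite inE -eval_at_val.
have /subsP[lW dl] := flat_subs l.
by rewrite eval_at_val; split=> //; move: vl; rewrite inE.
Qed.

Lemma card_supp_eval W j (v : word p W j) :
  #|supp_fun W j.+1 (eval_at v : _ -> 'F_p)| = weight v.
Proof. by rewrite supp_eval card_imset //; apply: val_inj. Qed.

Definition fun_word W j (f : {vspace V} -> 'F_p) : word p W j :=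
  [ffun l => f (val l)].

Lemma eval_fun_word W j f L : L \in subs W j.+1 ->
  eval_at (fun_word W j f) L = f L.
Proof.
rewrite inE => Lf; rewrite -[L]/(val (Sub L Lf : flat W j)) eval_at_val.
by rewrite ffunE.
Qed.

Lemma dual_fun_word W j k f : dual_fun W j.+1 k.+1 f ->
  dual_code p W j k (fun_word W j f).
Proof.
move=> fW; apply/dual_codeP => K KW; rewrite -[RHS](fW K KW).
apply: eq_bigr => L /(subsetP (subsS _ _)) LK; apply: eval_fun_word.
by apply: LK; case/subsP: KW.
Qed.

Lemma supp_fun_word W j f :
  supp_fun W j.+1 (eval_at (fun_word W j f) : _ -> 'F_p) = supp_fun W j.+1 f.
Proof.
by apply/setP => L; rewrite !inE; apply: andb_id2l => LW;
  rewrite eval_fun_word // inE.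
Qed.

Lemma word_neq0 W j (v : word p W j) :
  (v != 0) = (supp_fun W j.+1 (eval_at v : _ -> 'F_p) != set0).
Proof.
rewrite -card_gt0 card_supp_eval /weight lt0n; congr (~~ _).
apply/eqP/eqP => [->|v0]; first by apply: eq_card0 => l; rewrite inE ffunE eqxx.
apply/ffunP => l; rewrite ffunE; apply/eqP.
by have := card0_eq v0 l; rewrite inE => /negbFE.
Qed.

End FunctionsOfWords.

(** * Minimum weight words of the dual code in PG(n, q) *)

Lemma dim_PG (F : finFieldType) n : \dim (PG F n) = n.+1.
Proof. by rewrite dimvf /dim /= mul1n. Qed.

Theorem theorem7p8 (F : finFieldType) (p h n j k : nat)
    (p_prime : prime p) (card_F : #|F| = (p ^ h)%N)
    (j_gt0 : (0 < j)%N) (j_lt_k : (j < k)%N) (k_lt_n : (k < n)%N)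
    (v : word p (PG F n) j)
    (v_min : min_weight_word (dual_code p (PG F n) j k) v) :
  is_pullback k v /\
  exists iota : flat (PG F n) (j - 1),
    forall l : flat (PG F n) j, l \in support v -> (val iota <= val l)%VS.
Proof.
have [/dual_codeP dv v0 vmin] := v_min.
have F0 : #|F|%:R = 0 :> 'F_p.
  have : (1 < #|F|)%N by rewrite (cardD1 0) (cardD1 1) !inE oner_eq0.
  rewrite card_F; case: h {card_F} => [|h] // _.
  by rewrite expnS natrM pchar_Fp_0 // mul0r.
set f : {vspace 'rV[F]_n.+1} -> 'F_p := eval_at v in dv.
have f0 : supp_fun (PG F n) j.+1 f != set0 by rewrite -word_neq0.
have dPG := dim_PG F n.
(* Minimality of [v] becomes a bound on point words: a dual point word [g] on [X], pulled back along
   a complement of [X], is a dual word of weight at most that of [g]. *)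
have bnd : @point_bound F 'rV[F]_n.+1 'F_p (k.+1 - j.+1) (\dim (PG F n) - j.+1) 1
    #|supp_fun (PG F n) j.+1 f|.
  rewrite subSS dPG subSS => X g dX gX g0.
  pose A := (X^C)%VS.
  have dA : \dim A = j by rewrite dimv_compl -/(PG F n) dPG dX; dim_lia.
  have AX : (A :&: X = 0)%VS by rewrite capvC capv_compl.
  have AXf : (A + X = PG F n)%VS by rewrite addvC addv_complf.
  pose g' L : 'F_p := if (A <= L)%VS then g (L :&: X)%VS else 0.
  have g'W : dual_fun (PG F n) j.+1 k.+1 g'.
    have := pullback_dual AX gX; rewrite AXf dA.
    by have -> : (j + (k - j).+1 = k.+1)%N by dim_lia.
  have suppg : supp_fun (PG F n) j.+1 g' = [set (A + Q)%VS | Q in supp_fun X 1 g].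
    by rewrite -(supp_pullback _ AX) AXf dA.
  rewrite mul1n card_supp_eval.
  apply: leq_trans (vmin _ (dual_fun_word g'W) _) _.
    rewrite word_neq0 supp_fun_word suppg.
    by have [Q Qg] := set0Pn _ g0; apply/set0Pn; exists (A + Q)%VS; apply: imset_f.
  by rewrite -card_supp_eval supp_fun_word suppg leq_imset_card.
have [||A dA AL] := common_subspace F0 _ _ dv f0 bnd.
- by rewrite /= ltnS.
- by rewrite dPG.
rewrite /= in dA.
have Af : is_flat (PG F n) (j - 1) A.
  by rewrite /is_flat subvf dA subn1 prednK ?eqxx.
have Av l : l \in support v -> (A <= val l)%VS.
  by move=> vl; apply: AL; rewrite supp_eval imset_f.
split; last by exists (Sub A Af : flat (PG F n) (j - 1)).
pose X := (A^C)%VS.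
have dX : \dim X = (n - j).+1.
  by rewrite dimv_compl -/(PG F n) dPG dA; dim_lia.
have Xf : is_flat (PG F n) (n - j) X by rewrite /is_flat subvf dX eqxx.
have AX : (A :&: X = 0)%VS by rewrite capv_compl.
have AXf : (A + X = PG F n)%VS by rewrite addv_complf.
(* Any complement [X] of [A] serves; [c] reads off [v] on the j-spaces through [A]. *)
pose c := fun_word X 0 (fun Q => f (A + Q)%VS).
exists (Sub A Af), (Sub X Xf), c; split=> //=.
  apply: dual_fun_word => K /subsP[KX dK].
  have AKX : (A + K <= A + X)%VS by rewrite addvS.
  have := sum_pullback f AX (addvSl A K) AKX.
  have -> : ((A + K) :&: X = K)%VS by rewrite addvC -vspace_modl // AX addv0.
  move=> <-; rewrite dA -[RHS](dv (A + K)%VS).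
    (* Subspaces not containing [A] may be added to the sum, since [f] vanishes there. *)
    rewrite big_mkcondr; apply: eq_bigr => L /subsP[LAK dL].
    case: ifPn => // AL'; apply/esym/eqP; apply: contraNT AL' => fL.
    by apply: AL; apply/suppP; rewrite subvf.
  have AK : (A :&: K = 0)%VS by apply/eqP; rewrite -subv0 -AX capvS.
  by apply/subsP; rewrite subvf dimv_disjoint_sum // dA dK; split=> //; dim_lia.
apply/ffunP => l; rewrite ffunE.
have /subsP[_ dl] := flat_subs l.
case: ifPn => [Al|]; last by move=> nAl; apply/eqP; apply: contraNT nAl => /Av.
have lE : (A + (val l :&: X) = val l)%VS.
  by rewrite addvC vspace_modr // addvC AXf capvf.
rewrite eval_fun_word; first by rewrite lE /f eval_at_val.
apply/subsP; split; first exact: capvSr.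
apply/eqP; rewrite -(eqn_add2l (\dim A)) -dimv_disjoint_sum ?lE ?dl ?dA ?addn1 //.
by apply/eqP; rewrite -subv0 -AX capvS // capvSr.
Qed.
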